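(* Let $X$ be an infinite set and let $G,H\leq \mathrm{Sym}(X)$ be closed permutation groups on $X$, with $G$ primitive but not $2$-transitive on $X$, and with $H\leq G$. Let $n\in\mathbb{N}$, and suppose that $G$ and $H$ have the same orbits on the set $X^{[l]}$ for each $l\leq n+2^{n^2-n+2}-2$. Then $G$ and $H$ have the same orbits on $X^m$ for each $m\leq n$.
   Context: A permutation group on $X$ is a subgroup of $\mathrm{Sym}(X)$. It is closed if it is a closed subset of $\mathrm{Sym}(X)$ in the topology of pointwise convergence with respect to the discrete topology on $X$ (the basic open sets are the cosets of pointwise stabilisers of finite subsets of $X$). For a positive integer $l$, $X^{[l]}$ denotes the collection of unordered $l$-element subsets of $X$, and $X^m$ denotes the set of (ordered) $m$-tuples from $X$, with the coordinatewise action. $G$ is primitive on $X$ if it preserves no proper non-trivial equivalence relation on $X$ (i.e. the only $G$-invariant equivalence relations on $X$ are equality and the universal relation). $G$ is $2$-transitive if it is transitive on ordered pairs of distinct elements of $X$. *)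

(* Defs.v *)
Set Warnings "-notation-overridden,-notation-incompatible-prefix".
From HB Require Import structures.
From Corelib Require Import RelationClasses.
From mathcomp Require Export all_boot.
From mathcomp Require Export all_classical.
From mathcomp Require Export topology function_spaces.

Set Implicit Arguments.
Unset Strict Implicit.
Unset Printing Implicit Defensive.

Local Open Scope classical_set_scope.
Local Open Scope card_scope.

Record Sym (X : Type) := MkSym {
  sym_fun :> X -> X;
  sym_bij : bijective sym_fun }.

HB.instance Definition _ (X : Type) := gen_eqMixin (Sym X).
HB.instance Definition _ (X : Type) := gen_choiceMixin (Sym X).

Section SymGroup.
Variable X : Type.
Implicit Types s t : Sym X.

Lemma sym_ext s t : s =1 t -> s = t.
Proof.
case: s t => [f fb] [g gb] /= /funext fg; case: _ / fg gb => gb.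
by congr MkSym; apply: Prop_irrelevance.
Qed.

Fact sym_one_bij : bijective (@id X).
Proof. by exists id. Qed.

Fact sym_mul_bij s t : bijective (s \o t).
Proof. exact: bij_comp (sym_bij s) (sym_bij t). Qed.

Fact sym_inv_ex s : exists g : X -> X, cancel s g /\ cancel g s.
Proof. by have [g sg gs] := sym_bij s; exists g. Qed.

Fact sym_inv_bij s : bijective (sval (cid (sym_inv_ex s))).
Proof. by case: cid => g [sg gs]; exists s. Qed.

Definition sym_one := MkSym sym_one_bij.
Definition sym_mul s t := MkSym (sym_mul_bij s t).
Definition sym_inv s := MkSym (sym_inv_bij s).

Fact sym_mulA : associative sym_mul.
Proof. by move=> s t u; exact: sym_ext. Qed.

Fact sym_mul1 : left_id sym_one sym_mul.
Proof. by move=> s; exact: sym_ext. Qed.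

Fact sym_mulr1 : right_id sym_one sym_mul.
Proof. by move=> s; exact: sym_ext. Qed.

Fact sym_mulV : left_inverse sym_one sym_inv sym_mul.
Proof.
by move=> s; apply: sym_ext => x /=; case: cid => g [].
Qed.

Fact sym_mulrV : right_inverse sym_one sym_inv sym_mul.
Proof.
by move=> s; apply: sym_ext => x /=; case: cid => g [].
Qed.

(* The product is s * t = s \o t, so that Sym X acts on X on the left; this is
   the opposite of the convention of perm.v. *)
HB.instance Definition _ := isGroup.Build (Sym X)
  sym_mulA sym_mul1 sym_mulr1 sym_mulV sym_mulrV.

End SymGroup.

(* The topology induced on Sym X by pointwise convergence of maps X -> X, with
   X discrete; {classic X} only provides the choiceType that
   discrete_topology needs. *)
HB.instance Definition _ (X : Type) := Topological.copy (Sym X)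
  (initial_topology
     (@sym_fun X : Sym X -> {ptws X -> discrete_topology {classic X}})).

Section PermutationGroups.
Variable X : Type.
Implicit Types G H : set (Sym X).

Definition permutation_group G := group_closed [in G].

Definition closed_permutation_group G := permutation_group G /\ closed G.

Definition primitive G := forall R : X -> X -> Prop,
  Equivalence R ->
  (forall s, G s -> forall x y, R (s x) (s y) <-> R x y) ->
  (forall x y, R x y <-> x = y) \/ (forall x y, R x y).

Definition two_transitive G := forall x1 x2 y1 y2 : X,
  x1 <> x2 -> y1 <> y2 -> exists2 s, G s & s x1 = y1 /\ s x2 = y2.

Definition sym_orbit (T : Type) (act : Sym X -> T -> T) G (t : T) : set T :=
  [set act s t | s in G].

Definition sym_orbits (T : Type) (act : Sym X -> T -> T) G (D : set T) :
  set (set T) := [set sym_orbit act G t | t in D].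

Definition subset_act (s : Sym X) (A : set X) : set X := s @` A.

Definition tuple_act m (s : Sym X) (t : m.-tuple X) : m.-tuple X :=
  [tuple of map s t].

Definition lsubsets l : set (set X) := [set A | A #= `I_l].

Definition same_orbits_on_subsets l G H :=
  sym_orbits subset_act G (lsubsets l) = sym_orbits subset_act H (lsubsets l).

Definition same_orbits_on_tuples m G H :=
  sym_orbits (@tuple_act m) G setT = sym_orbits (@tuple_act m) H setT.

End PermutationGroups.

(* Main.v *)
(* If A is a finite set with at most N = n + 2^(n^2-n+2) - 2 elements and g lies
   in G, some h in H has h(A) = g(A), so h^-1 g acts on A as an automorphism of
   every G-invariant relation.  The point is to embed n given points in such an A
   so that these automorphisms are controlled on the n points.

   Since G is primitive and not 2-transitive, there is a G-invariant graph or
   tournament R in which any two points are separated by infinitely many others.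
   Indeed, having only finitely many separators is a G-invariant equivalence; if
   it is universal, points with nearly equal neighbourhoods form a locally finite
   connected graph, and "at positive even distance" is the required graph.

   Ramsey's theorem then gives, for each pair of the given points, a block of
   separators, the blocks being homogeneous and mutually uniform, of sizes
   (p + 2) 2^k for p given points.  In the graph case the degree of a vertex encodes in binary the
   blocks it sees, whence the given points have distinct degrees, up to a small
   error.  They may still be confused with block vertices; counting tuples in
   a fixed H-orbit over A and over A minus some of the given points removes this
   ambiguity by inclusion-exclusion.  In the tournament case A is rigid. *)

Require Import Defs.
From mathcomp Require Import zify.

Set Implicit Arguments.
Unset Strict Implicit.
Unset Printing Implicit Defensive.

Local Open Scope classical_set_scope.
Local Open Scope nat_scope.

(** * Ramsey's theorem *)

Lemma infinite_fiber (T I : Type) (F : set I) (A : set T) (f : I -> set T) :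
  finite_set F -> infinite_set A -> A `<=` \bigcup_(i in F) f i ->
  exists2 i, F i & infinite_set (A `&` f i).
Proof.
move=> Ffin Ainf AF; apply: contrapT => noi; apply: Ainf.
apply: (@sub_finite_set _ _ (\bigcup_(i in F) (A `&` f i))).
  by move=> x Ax; have [i Fi fix_] := AF x Ax; exists i.
apply: bigcup_finite => // i Fi.
by apply: contrapT => Aif; apply: noi; exists i.
Qed.

Lemma infinite_sequence (T : Type) (A : set T) : infinite_set A ->
  exists2 f : nat -> T, injective f & forall i, A (f i).
Proof.
elim/Ppointed: T => T in A *.
  by rewrite emptyE => Ainf; exfalso; apply: Ainf; exact: finite_set0.
move=> /infiniteP/pcard_leP[f]; exists f => [i j|i]; last exact: funS.
by apply: inj; rewrite inE.
Qed.

Lemma infinite_gt (A : set nat) (n : nat) :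
  infinite_set A -> infinite_set (A `&` [set m | n < m]).
Proof.
move=> Ainf fin; apply: Ainf.
apply: (@sub_finite_set _ _ ((A `&` [set m | n < m]) `|` `I_n.+1)).
  by move=> m Am; case: (ltnP n m) => nm; [left|right].
by rewrite finite_setU; split => //; exact: finite_II.
Qed.

Lemma increasing_enum (A : set nat) : infinite_set A ->
  exists2 e : nat -> nat, {homo e : i j / i < j} & forall i, A (e i).
Proof.
move=> Ainf.
have larger n : exists m, A m /\ n < m.
  by have /infinite_setN0 [m [Am nm]] := infinite_gt (n := n) Ainf; exists m.
have [nxt nxtP] := choice larger.
exists (fun i => iter i.+1 nxt 0) => [|i]; last by case: (nxtP (iter i nxt 0)).
apply: homo_ltn; first exact: ltn_trans.
by move=> i; case: (nxtP (iter i.+1 nxt 0)).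
Qed.

(** Along a decreasing chain of infinite sets [P i], a chosen element [m i] of [P i] sees all of
    [P i.+1] in one colour [c i]; pigeonhole on these colours thins the chosen elements to a
    homogeneous sequence. *)
Lemma ramsey (C : finType) (col : nat -> nat -> C) :
  exists (c : C) (e : nat -> nat), {homo e : i j / i < j} /\
    forall i j, i < j -> col (e i) (e j) = c.
Proof.
have step (P : set nat) : exists p : nat * C * set nat, infinite_set P ->
    [/\ P p.1.1, p.2 `<=` P, infinite_set p.2 &
        forall j, p.2 j -> p.1.1 < j /\ col p.1.1 j = p.1.2].
  case: (pselect (infinite_set P)) => [Pinf|nP]; last first.
    (* A finite [P] gets a junk value, so that [choice] yields a total step function. *)
    by exists (0, col 0 0, set0).
  have [m Pm] := infinite_setN0 Pinf.
  have [||c _ cinf] :=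
    @infinite_fiber _ C setT _ (fun c => [set j | col m j = c])
      _ (infinite_gt (n := m) Pinf).
  - exact: finite_finset.
  - by move=> j _; exists (col m j).
  exists (m, c, P `&` [set j | m < j] `&` [set j | col m j = c]) => _.
  by split => //= [j [[]]|j [[_ mj] mc]].
have [F FP] := choice step.
pose P i := iter i (fun Q => (F Q).2) setT.
have Pinf i : infinite_set (P i).
  by elim: i => [|i IH]; [exact: infinite_nat | case: (FP _ IH)].
have Psub i j : i <= j -> P j `<=` P i.
  move=> /subnK <-; elim: (j - i) => // k IH x.
  by rewrite addSn /= => Px; apply: IH; case: (FP _ (Pinf (k + i))) => _ + _ _; apply.
pose m i := (F (P i)).1.1; pose c i := (F (P i)).1.2.
have mP i j : i < j -> m i < m j /\ col (m i) (m j) = c i.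
  move=> ij; have [_ _ _] := FP _ (Pinf i); apply.
  by apply: (Psub _ _ ij); case: (FP _ (Pinf j)).
have [||c0 _ cinf] :=
  @infinite_fiber _ C setT _ (fun d => [set i | c i = d]) _ infinite_nat.
- exact: finite_finset.
- by move=> j _; exists (c j).
have [e eh eP] := increasing_enum cinf.
exists c0, (m \o e); split => i j ij /=; first by case: (mP _ _ (eh _ _ ij)).
by case: (mP _ _ (eh _ _ ij)) => _ ->; case: (eP i).
Qed.

(** * Invariant relations *)

Definition rel_invariant (X : Type) (G : set (Sym X)) (R : rel X) :=
  forall s, G s -> forall x y, R (s x) (s y) = R x y.

Definition separators (X : Type) (R : rel X) (x y : X) : set X :=
  [set z | R x z != R y z].

Definition separating (X : Type) (R : rel X) :=
  forall x y, x <> y -> infinite_set (separators R x y).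

Definition tournament (X : Type) (R : rel X) :=
  forall x y, x <> y -> R y x = ~~ R x y.

Section PermutationGroups.
Variables (X : Type) (G : set (Sym X)).
Hypothesis G_group : permutation_group G.

Lemma permutation_group1 : G 1%g.
Proof. by case: G_group => /set_mem. Qed.

Lemma permutation_groupM s t : G s -> G t -> G (s * t)%g.
Proof.
by move=> /mem_set Gs /mem_set Gt; exact: set_mem (group_closedM G_group Gs Gt).
Qed.

Lemma permutation_groupV s : G s -> G s^-1%g.
Proof.
by move=> /mem_set Gs; exact: set_mem (group_closedV G_group Gs).
Qed.

Lemma sym_invK (s : Sym X) : cancel s s^-1%g.
Proof. by move=> x; rewrite -[LHS]/((s^-1 * s)%g x) mulVg. Qed.

End PermutationGroups.

(** * Separating relations from primitivity *)

Section Separation.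
Local Open Scope card_scope.
Variables (X : Type) (G : set (Sym X)).
Hypotheses (X_infinite : infinite_set [set: X]) (G_primitive : primitive G).
Implicit Types R : rel X.

Lemma sym_inj (s : Sym X) : injective s.
Proof. exact: bij_inj (sym_bij s). Qed.

Lemma sym_neq (s : Sym X) x y : s x <> s y <-> x <> y.
Proof. by split=> xy => [xy0|/sym_inj//]; apply: xy; rewrite xy0. Qed.

Lemma separatorsC R x y : separators R x y = separators R y x.
Proof. by apply/seteqP; split=> z; rewrite /separators /= eq_sym. Qed.

Lemma separators_image R s x y : rel_invariant G R -> G s ->
  separators R (s x) (s y) = s @` separators R x y.
Proof.
move=> Rinv Gs; apply/seteqP; split=> [z|_ [z + <-]]; last first.
  by rewrite /separators /= !Rinv.
have [t ts st] := sym_bij s.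
by rewrite /separators /= -(st z) !Rinv // => xy; exists (t z).
Qed.

(** A separator of [x] and [z] separates [x] from [y] or [y] from [z], whence transitivity;
    primitivity leaves equality or the universal relation. *)
Lemma separating_dichotomy R : rel_invariant G R ->
  separating R \/ forall x y, finite_set (separators R x y).
Proof.
move=> Rinv.
have [||sep|fin] := @G_primitive (fun x y => finite_set (separators R x y)).
- split=> [x|x y|x y z].
  + by apply: (@sub_finite_set _ _ set0) => // z /eqP.
  + by rewrite separatorsC.
  + move=> xy yz.
    apply: (@sub_finite_set _ _ (separators R x y `|` separators R y z)).
      move=> w; rewrite /separators /=.
      by case: (R x w =P R y w) => [->|/eqP]; [right|left].
    by rewrite finite_setU.
- move=> s Gs x y; rewrite separators_image //.
  by rewrite (eq_finite_set (inj_card_eq (in2W (@sym_inj s)))).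
- by left=> x y xy /sep.
- by right.
Qed.

Definition graph (R : rel X) := symmetric R /\ irreflexive R.

Fixpoint walk R k x y : Prop :=
  if k is k'.+1 then exists2 z, R x z & walk R k' z y else x = y.

Lemma walk_cat R k l x y z :
  walk R k x y -> walk R l y z -> walk R (k + l) x z.
Proof.
elim: k x => [x ->//|k IH x [w xw wy] yz]; by exists w => //; exact: IH.
Qed.

Lemma walk_sym R k x y : symmetric R -> walk R k x y -> walk R k y x.
Proof.
move=> Rsym; elim: k x => [x ->//|k IH x [w xw /IH yw]].
by rewrite -addn1; apply: walk_cat yw _; exists x; rewrite // Rsym.
Qed.

Lemma walk_act R s k x y : rel_invariant G R -> G s ->
  walk R k (s x) (s y) <-> walk R k x y.
Proof.
move=> Rinv Gs; elim: k x => [x|k IH x] /=.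
  by split=> [/sym_inj|->].
have [t ts st] := sym_bij s.
split=> [[z]|[z xz zy]]; last by exists (s z); [rewrite Rinv | apply/IH].
by rewrite -(st z) Rinv // => xz /IH zy; exists (t z).
Qed.

(** Being joined by a walk is a [G]-invariant equivalence, and an edge, whose ends differ by
    irreflexivity, rules out equality. *)
Lemma walk_connected R : graph R -> rel_invariant G R ->
  (exists x y, R x y) -> forall x y, exists k, walk R k x y.
Proof.
move=> [Rsym Rirr] Rinv [x0 [y0 xy0]].
have [||sep|//] := @G_primitive (fun x y => exists k, walk R k x y).
- split=> [x|x y [k /(walk_sym Rsym) xy]|x y z [k xy] [l yz]].
  + by exists 0.
  + by exists k.
  + by exists (k + l); exact: walk_cat xy yz.
- by move=> s Gs x y; split=> -[k xy]; exists k; apply/(walk_act _ _ _ Rinv Gs).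
- have /sep xy : exists k, walk R k x0 y0 by exists 1; exists y0.
  by move: xy0; rewrite xy Rirr.
Qed.

(* Distances from a vertex o and from its neighbour on a geodesic to z have
   opposite parities, and with finitely many neighbours some neighbour of o
   serves infinitely many z. *)
Lemma locally_finite_separating R : graph R -> rel_invariant G R ->
  (exists x y, R x y) -> (forall x, finite_set [set z | R x z]) ->
  exists R', [/\ graph R', rel_invariant G R' & separating R'].
Proof.
move=> Rgr Rinv Redge Rfin; have [Rsym _] := Rgr.
have conn x y : exists k, `[< walk R k x y >].
  by have [k xy] := walk_connected Rgr Rinv Redge x y; exists k; apply/asboolP.
pose d x y := ex_minn (conn x y).
have dwalk x y : walk R (d x y) x y by rewrite /d; case: ex_minnP => k /asboolP.
have dmin x y k : walk R k x y -> d x y <= k.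
  by move=> /asboolP xy; rewrite /d; case: ex_minnP => l _; apply.
have dsym x y : d x y = d y x.
  by apply/eqP; rewrite eqn_leq !dmin //; exact: walk_sym.
have dinv s x y : G s -> d (s x) (s y) = d x y.
  move=> Gs; apply/eqP; rewrite eqn_leq !dmin //.
    exact/(walk_act _ _ _ Rinv Gs).
  by apply/(walk_act _ _ _ Rinv Gs).
have dstep o z : o <> z -> exists2 y, R o y & d o z = (d y z).+1.
  move=> oz; have := dwalk o z; case E: (d o z) => [//|k] [y oy yz].
  exists y => //; apply/eqP; rewrite eqSS eqn_leq dmin // andbT.
  by rewrite -ltnS -E; apply: dmin; exists y.
pose R' x y := `[< x <> y >] && ~~ odd (d x y).
have R'inv : rel_invariant G R'.
  move=> s Gs x y; rewrite /R' dinv //; congr (_ && _).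
  exact/asbool_equiv_eq/sym_neq.
exists R'; split=> //.
  split=> [x y|x]; rewrite /R'; last by case: asboolP.
  by rewrite dsym; congr (_ && _); apply: asbool_equiv_eq; split=> /nesym.
have [//|R'fin] := separating_dichotomy R'inv.
have [o _] := infinite_setN0 X_infinite.
have oinf : infinite_set ([set: X] `\` [set o]).
  by apply: infinite_setD => //; exact: finite_set1.
have [z [_ /= /nesym oz]|y oy yinf] :=
    @infinite_fiber _ X [set y | R o y] _ (fun y => [set z | d o z = (d y z).+1])
      (Rfin o) oinf.
  by have [y oy yz] := dstep _ _ oz; exists y.
exfalso; apply: yinf.
(* The point [y] is set aside: it is at odd distance from [o] and at distance 0 from itself, so [R']
   holds in neither case. *)
apply: (@sub_finite_set _ _ (separators R' o y `|` [set y])).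
  move=> z [[_ /= /nesym oz] dz]; case: (pselect (y = z)) => [->|yz]; first by right.
  left; rewrite /separators /R' /=.
  by do 2![case: asboolP => // _]; rewrite dz /=; case: odd.
by rewrite finite_setU; split; [exact: R'fin | exact: finite_set1].
Qed.

(** Outside a finite union of finite sets, a point of [Z] disagrees with [o] on [m.+1] chosen points
    of [B], all of which are then separators. *)
Lemma large_difference R o (Z B : set X) m :
  infinite_set Z -> infinite_set B ->
  (forall j, B j -> finite_set (Z `&` [set z | R o j = R z j])) ->
  exists2 z, Z z & ~ (separators R o z #<= `I_m).
Proof.
move=> Zinf /infinite_sequence [f finj fB] ZB.
have : infinite_set (Z `\` \bigcup_(i in `I_m.+1) (Z `&` [set z | R o (f i) = R z (f i)])).
  apply: infinite_setD => //; apply: bigcup_finite; first exact: finite_II.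
  by move=> i _; exact: ZB.
move=> /infinite_setN0 [z [Zz nz]]; exists z => // small.
suff : `I_m.+1 #<= `I_m by rewrite card_le_II ltnn.
apply: card_le_trans small.
have /card_eqPle [_ le1] : f @` `I_m.+1 #= `I_m.+1 by apply: inj_card_eq; exact: in2W.
apply: card_le_trans le1 _; apply: subset_card_le => _ [i im <-].
by rewrite /separators /=; apply/eqP => eqz; apply: nz; exists i.
Qed.

(** If some pair has [m] separators, joining distinct points with at most [m] separators gives an
    invariant graph with an edge, locally finite by hypothesis. *)
Lemma close_pairs_separating R : rel_invariant G R ->
  (forall x y, finite_set (separators R x y)) ->
  (forall o m, finite_set [set z | o <> z /\ separators R o z #<= `I_m]) ->
  exists R', [/\ graph R', rel_invariant G R' & separating R'].
Proof.
move=> Rinv Rfin close.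
have [u _] := infinite_setN0 X_infinite.
have [v [_ /= uv]] : ([set: X] `\` [set u]) !=set0.
  by apply/infinite_setN0/infinite_setD => //; exact: finite_set1.
have [m um] := Rfin u v.
apply: (@locally_finite_separating
  (fun x y => `[< x <> y /\ separators R x y #<= `I_m >])).
- split=> [x y|x]; last by apply/asboolP => -[].
  by apply: asbool_equiv_eq; rewrite separatorsC; split=> -[/nesym].
- move=> s Gs x y; apply: asbool_equiv_eq; rewrite separators_image //.
  rewrite (card_le_eql (inj_card_eq (in2W (@sym_inj s)))).
  by rewrite sym_neq.
- exists u, v; apply/asboolP; split; first exact: nesym.
  by move: um; rewrite card_eq_le => /andP[].
- by move=> x; apply: sub_finite_set (close x m) => z /asboolP.
Qed.

Lemma graph_separating R : graph R -> rel_invariant G R ->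
  (exists x y, R x y) -> (exists x y, x <> y /\ ~~ R x y) ->
  exists R', [/\ graph R', rel_invariant G R' & separating R'].
Proof.
move=> Rgr Rinv Redge Rnonedge; have [Rsym Rirr] := Rgr.
have [Rsep|Rfin] := separating_dichotomy Rinv; first by exists R.
(* Any two neighbourhoods now differ finitely, so if one is finite, all are; likewise in the
   complement graph. *)
case: (pselect (exists o, finite_set [set z | R o z])) => [[o ofin]|infR].
  apply: (locally_finite_separating Rgr) => // x.
  apply: (@sub_finite_set _ _ ([set z | R o z] `|` separators R o x)).
    by move=> z /=; rewrite /separators /= => ->; case: (R o z); [left|right].
  by rewrite finite_setU.
case: (pselect (exists o, finite_set [set z | ~~ R o z])) => [[o ofin]|infRC].
  apply: (@locally_finite_separating (fun x y => `[< x <> y >] && ~~ R x y)).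
  - split=> [x y|x]; last by case: asboolP.
    by rewrite Rsym; congr (_ && _); apply: asbool_equiv_eq; split=> /nesym.
  - move=> s Gs x y; rewrite Rinv //; congr (_ && _).
    exact/asbool_equiv_eq/sym_neq.
  - by have [x [y [/asboolP xy Rxy]]] := Rnonedge; exists x, y; rewrite xy.
  - move=> x.
    apply: (@sub_finite_set _ _ ([set z | ~~ R o z] `|` separators R o x)).
      move=> z /= /andP[_]; rewrite /separators /= => /negbTE ->.
      by case: (R o z); [right|left].
    by rewrite finite_setU.
apply: (close_pairs_separating Rinv Rfin) => o m.
apply: contrapT => Zinf; set Z := [set z | _] in Zinf.
have [|z1 z1inf] := @infinite_fiber _ bool setT _ (fun b => [set z | R o z = b])
    finite_finset Zinf.
  by move=> z _; exists (R o z).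
move=> Zbinf.
(* For [j] with [R o j = ~~ z1], any [z] with [R o z = z1] and [R z j = R o j] separates [o] and [j]
   by symmetry, so there are finitely many such [z]. *)
have Binf : infinite_set [set j | R o j = ~~ z1].
  case: z1 z1inf Zbinf => _ _ fin.
    by apply: infRC; exists o; apply: sub_finite_set fin => j /= /negbTE.
  by apply: infR; exists o.
have [j /= oj|z [[_ small] _] nsmall] := large_difference (R := R) (o := o) m Zbinf Binf.
  apply: sub_finite_set (Rfin o j) => z [[_ /= oz] zj].
  by rewrite /separators /= oz Rsym -zj oj; case: (z1).
exact: nsmall.
Qed.

Lemma tournament_separating R : irreflexive R -> tournament R ->
  rel_invariant G R ->
  separating R \/ exists R', [/\ graph R', rel_invariant G R' & separating R'].
Proof.
move=> Rirr Rtour Rinv.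
have [Rsep|Rfin] := separating_dichotomy Rinv; first by left.
right; apply: (close_pairs_separating Rinv Rfin) => o m.
apply: contrapT => Zinf; set Z := [set z | _] in Zinf.
have [|b _ Zbinf] := @infinite_fiber _ bool setT _ (fun b => [set z | R o z = b])
    finite_finset Zinf.
  by move=> z _; exists (R o z).
(* The same infinite set plays both roles: if [R o z = R o j = R z j] and [z <> j], then [R j z] is
   opposite, and [z] separates [o] and [j]. *)
have [j [_ /= oj]|z [[_ small] _] nsmall] := large_difference (R := R) (o := o) m Zbinf Zbinf.
  apply: (@sub_finite_set _ _ (separators R o j `|` [set j])).
    move=> z [[_ /= oz] zj]; case: (pselect (z = j)) => [->|znj]; first by right.
    by left; rewrite /separators /= oz Rtour // -zj oj; case: (b).
  by rewrite finite_setU; split; [exact: Rfin | exact: finite_set1].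
exact: nsmall.
Qed.

Lemma orbital_separating : permutation_group G -> ~ two_transitive G ->
  exists R, [/\ irreflexive R, rel_invariant G R, separating R &
    symmetric R \/ tournament R].
Proof.
move=> Ggrp.
suff cases : ~ two_transitive G ->
    (exists R, [/\ graph R, rel_invariant G R & separating R]) \/
    (exists R, [/\ irreflexive R, tournament R, rel_invariant G R & separating R]).
  move=> /cases[[R [[Rsym Rirr] Rinv Rsep]]|[R [Rirr Rt Rinv Rsep]]].
    by exists R; split=> //; left.
  by exists R; split=> //; right.
move=> /existsNP[x1 /existsNP[x2 /existsNP[y1 /existsNP[y2]]]].
move=> /not_implyP[x12 /not_implyP[y12 noy]].
(* The orbital of [(x1, x2)], which misses [(y1, y2)]. *)
pose R x y := `[< exists2 s, G s & s x1 = x /\ s x2 = y >].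
have R0 : R x1 x2 by apply/asboolP; exists 1%g => //; exact: permutation_group1.
have Rirr : irreflexive R.
  by move=> x; apply/asboolP => -[s _ [<- /sym_inj/esym]].
have Rinv : rel_invariant G R.
  move=> s Gs x y; apply: asbool_equiv_eq; split=> -[t Gt [tx ty]].
    exists (s^-1 * t)%g; first exact: permutation_groupM (permutation_groupV _ _) _.
    by split; rewrite -[LHS]/(s^-1%g (t _)) ?tx ?ty sym_invK.
  exists (s * t)%g; first exact: permutation_groupM.
  by rewrite -tx -ty.
pose S x y := R x y || R y x.
have Sgr : graph S.
  by split=> [x y|x]; rewrite /S ?Rirr // orbC.
have Sinv : rel_invariant G S by move=> s Gs x y; rewrite /S !Rinv.
case: (pselect (exists x y, x <> y /\ ~~ S x y)) => [nonedge|complete].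
  left; apply: (graph_separating Sgr Sinv _ nonedge).
  by exists x1, x2; rewrite /S R0.
have {}complete x y : x <> y -> S x y.
  by move=> xy; apply: contrapT => /negP Sxy; apply: complete; exists x, y.
have Rtour : tournament R.
  move=> x y xy; have := complete _ _ xy; rewrite /S.
  case Rxy : (R x y); case Ryx : (R y x) => //= _; exfalso; apply: noy.
  (* Arcs in both directions put [(x2, x1)] in the orbital, which is then symmetric and by
     completeness contains [(y1, y2)]. *)
  have R21 : R x2 x1.
    move: Rxy Ryx => /asboolP[s Gs [sx sy]] /asboolP[t Gt [ty tx]].
    rewrite -(Rinv s) // sx sy; apply/asboolP.
    by exists t.
  have Rsym u v : R u v -> R v u.
    by move=> /asboolP[s Gs [<- <-]]; rewrite Rinv.
  have : R y1 y2 by have /orP[//|/Rsym] := complete _ _ y12.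
  by move=> /asboolP.
have [Rsep|] := tournament_separating Rirr Rtour Rinv; last by left.
by right; exists R.
Qed.

End Separation.

(** * Extending a tuple by blocks of separators *)

Section Blocks.
Variables (p r : nat) (t : 'I_r -> nat).

(** Abstract vertex set of the finite configuration: the given points, and [t k] separators of the
    [k]-th pair. *)
Definition blocks : finType := ('I_p + {k : 'I_r & 'I_(t k)})%type.

Definition pt (i : 'I_p) : blocks := inl i.

Definition blk k (i : 'I_(t k)) : blocks := inr (Tagged (fun k => 'I_(t k)) i).

Definition in_block (k : 'I_r) (v : blocks) :=
  if v is inr u then tag u == k else false.

Lemma blk_inj k : injective (@blk k).
Proof. by move=> i j [/eqP]; rewrite eq_Tagged => /eqP. Qed.

Lemma in_blockP k v : reflect (exists i, v = @blk k i) (in_block k v).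
Proof.
case: v => [i|[l i]] /=; first by constructor=> -[].
apply: (iffP eqP) => [lk|[j E]]; first by case: _ / lk; exists i.
have : in_block k (@blk k j) by rewrite /= eqxx.
by rewrite -E => /eqP.
Qed.

Lemma blocks_ind (P : blocks -> Prop) :
  (forall i, P (pt i)) -> (forall k i, P (@blk k i)) -> forall v, P v.
Proof. by move=> Ppt Pblk [i|[k i]]; [exact: Ppt|exact: Pblk]. Qed.

(* Ramsey's theorem is applied to the sequence of vectors (z k i)_k; since the
   blocks use disjoint increasing intervals of indices i, it makes each block
   indiscernible and any two of them mutually uniform. *)
Lemma uniform_blocks (X : Type) (R : rel X) (x : 'I_p -> X) (Z : 'I_r -> set X) :
  injective x -> (forall k, infinite_set (Z k)) ->
  exists (a : blocks -> X) (b : blocks -> 'I_r -> bool) (c d : 'I_r -> bool),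
  [/\ injective a, forall i, a (pt i) = x i, forall k i, Z k (a (@blk k i)),
    forall v k i, ~~ in_block k v -> R (a v) (a (@blk k i)) = b v k &
    forall k (i j : 'I_(t k)), i < j ->
      R (a (blk i)) (a (blk j)) = c k /\ R (a (blk j)) (a (blk i)) = d k].
Proof.
move=> xinj Zinf.
have seqZ k : exists f : nat -> X, injective f /\ forall i, Z k (f i).
  by have [f finj fZ] := infinite_sequence (Zinf k); exists f.
have [z zP] := choice seqZ.
have zinj k : injective (z k) by case: (zP k).
have zZ k i : Z k (z k i) by case: (zP k).
(* Equalities are coloured along with [R], so that homogeneity also forces distinctness. *)
pose pattern i j :=
  ([ffun kl : 'I_r * 'I_r => (R (z kl.1 i) (z kl.2 j), R (z kl.2 j) (z kl.1 i),
       `[< z kl.1 i = z kl.2 j >])],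
   [ffun sk : 'I_p * 'I_r => (R (x sk.1) (z sk.2 i), `[< x sk.1 = z sk.2 i >])]).
have [[P Q] [e [eincr eP]]] := ramsey pattern.
have PE k l i j : i < j -> P (k, l) =
    (R (z k (e i)) (z l (e j)), R (z l (e j)) (z k (e i)),
     `[< z k (e i) = z l (e j) >]).
  by move=> /eP[<- _]; rewrite ffunE.
have QE s k i : Q (s, k) = (R (x s) (z k (e i)), `[< x s = z k (e i) >]).
  by have [_ <-] := eP _ _ (ltnSn i); rewrite ffunE.
(* By homogeneity one coincidence would persist from [j] to [j.+1], against injectivity of [z l]. *)
have zdist k l i j : i < j -> z k (e i) <> z l (e j).
  move=> ij zij.
  have : (P (k, l)).2 = true by rewrite (PE _ _ _ _ ij); apply/asboolP.
  rewrite (PE _ _ i j.+1) ?ltnS 1?ltnW //= => /asboolP; rewrite zij => /zinj.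
  by have := eincr _ _ (ltnSn j) => /[swap] ->; rewrite ltnn.
have xdist s k i : x s <> z k (e i).
  move=> xz; have : (Q (s, k)).2 = true by rewrite (QE _ _ i); apply/asboolP.
  rewrite (QE _ _ i.+1) => /asboolP; rewrite xz => /zinj.
  by have := eincr _ _ (ltnSn i) => /[swap] <-; rewrite ltnn.
pose M := \sum_k t k.
have tM k : t k <= M by rewrite /M (bigD1 k) //= leq_addr.
pose idx k (i : 'I_(t k)) := k * M + i.
have idx_lt k l (i : 'I_(t k)) (j : 'I_(t l)) : k < l -> idx _ i < idx _ j.
  move=> kl; have := leq_trans (ltn_ord i) (tM k).
  have : k.+1 * M <= l * M by rewrite leq_mul2r kl orbT.
  rewrite /idx; lia.
pose a (v : blocks) := match v with
  | inl s => x s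
  | inr u => z (tag u) (e (idx (tag u) (tagged u))) end.
pose b (v : blocks) k := match v with
  | inl s => (Q (s, k)).1
  | inr u => if tag u < k then (P (tag u, k)).1.1 else (P (k, tag u)).1.2 end.
exists a, b, (fun k => (P (k, k)).1.1), (fun k => (P (k, k)).1.2); split=> //.
- elim/blocks_ind => [i|k i]; elim/blocks_ind => [j|l j] /=.
  + by move=> /xinj ->.
  + by move=> /xdist.
  + by move=> /esym/xdist.
  + case: (ltngtP (idx _ i) (idx _ j)) => [lt zij|lt zij|ij _].
    * by case: (zdist k l _ _ lt).
    * by case: (zdist l k _ _ lt).
    * have kl : k = l.
        apply/val_inj; case: (ltngtP k l) => // lt.
          by have := idx_lt _ _ i j lt; rewrite ij ltnn.
        by have := idx_lt _ _ j i lt; rewrite ij ltnn.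
      case: _ / kl in j ij *.
      by congr blk; apply/val_inj/eqP; rewrite -(eqn_add2l (k * M)); apply/eqP.
- by move=> k i; exact: zZ.
- elim/blocks_ind => [s|l j] k i /=; first by move=> _; rewrite (QE s k (idx k i)).
  move=> lk; case: (ltngtP l k) => [lt|gt|/val_inj kl].
  + by rewrite (PE _ _ _ _ (idx_lt _ _ j i lt)).
  + by rewrite (PE _ _ _ _ (idx_lt _ _ i j gt)).
  + by rewrite kl eqxx in lk.
- move=> k i j ij /=; have lt : idx k i < idx k j by rewrite ltn_add2l.
  by rewrite (PE _ _ _ _ lt).
Qed.

End Blocks.

(** * Automorphisms of the block configuration *)

(** Uniqueness of binary expansions: parity gives the lowest digit, halving the others. *)
Lemma binary_inj r (b b' : 'I_r -> bool) :
  \sum_k b k * 2 ^ k = \sum_k b' k * 2 ^ k -> b =1 b'.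
Proof.
elim: r b b' => [|r IH] b b' ; first by move=> _ [].
rewrite !big_ord_recl /= !muln1.
have shift (f : 'I_r.+1 -> bool) :
    \sum_(i < r) f (lift ord0 i) * 2 ^ bump 0 i =
    (\sum_(i < r) f (lift ord0 i) * 2 ^ i).*2.
  rewrite -mul2n big_distrr /=; apply: eq_bigr => i _.
  by rewrite /bump /= add1n expnS mulnCA.
rewrite !shift => eqs.
have b0 : b ord0 = b' ord0 by move/(congr1 odd): eqs; rewrite !oddD !odd_double !addbF !oddb.
have {}eqs : \sum_(i < r) b (lift ord0 i) * 2 ^ i = \sum_(i < r) b' (lift ord0 i) * 2 ^ i.
  by apply: double_inj; move: eqs; rewrite b0 => /addnI.
move=> k; case: (unliftP ord0 k) => [i|] -> //.
exact: (IH (b \o lift ord0) (b' \o lift ord0)).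
Qed.

(** Induction on the list of indices required to be met: those meeting [q] are all minus those
    avoiding [q], and the hypothesis settles the empty list. *)
Lemma inclusion_exclusion (I S : finType) (W : {set S}) (M : S -> pred I)
    (P P' : pred S) :
  (forall J : {set I}, #|[set s in W | [forall j in J, ~~ M s j] && P s]| =
                       #|[set s in W | [forall j in J, ~~ M s j] && P' s]|) ->
  #|[set s in W | [forall i, M s i] && P s]| =
  #|[set s in W | [forall i, M s i] && P' s]|.
Proof.
move=> eqJ.
suff eqQ (Q : seq I) (J : {set I}) :
    #|[set s in W | all (M s) Q && ([forall j in J, ~~ M s j] && P s)]| =
    #|[set s in W | all (M s) Q && ([forall j in J, ~~ M s j] && P' s)]|.
  have full (F : pred S) : [set s in W | [forall i, M s i] && F s] =
      [set s in W | all (M s) (enum I) && ([forall j in finset.set0, ~~ M s j] && F s)].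
    apply/setP => s; rewrite !inE; congr (_ && _).
    have -> /= : [forall j in finset.set0, ~~ M s j].
      by apply/forall_inP => j; rewrite inE.
    congr (_ && _); apply/forallP/allP => [h i _|h i]; first exact: h.
    by apply: h; rewrite mem_enum.
  by rewrite !full eqQ.
elim: Q J => [|q Q IH] J; first exact: eqJ.
have split_q (F : pred S) :
    #|[set s in W | all (M s) Q && ([forall j in J, ~~ M s j] && F s)]| =
    #|[set s in W | all (M s) (q :: Q) && ([forall j in J, ~~ M s j] && F s)]| +
    #|[set s in W | all (M s) Q && ([forall j in q |: J, ~~ M s j] && F s)]|.
  rewrite -(cardsID [set s | M s q]); congr (_ + _); apply: eq_card => s.
    by rewrite !inE /= andbC; case: (M s q); rewrite ?andbF.
  rewrite !inE; have -> : [forall j in q |: J, ~~ M s j] =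
      ~~ M s q && [forall j in J, ~~ M s j].
    apply/forall_inP/andP => [h|[nq /forall_inP h] j].
      split; first by apply: h; rewrite setU11.
      by apply/forall_inP => j jJ; apply: h; rewrite setU1r.
    by rewrite !inE => /orP[/eqP->//|]; exact: h.
  by case: (M s q); rewrite /= ?andbF.
by apply/eqP; have := split_q P; rewrite IH (split_q P') IH => /addIn ->.
Qed.

Section FiniteRelations.
Variables (T : finType) (e : rel T).

Definition outdeg (D : {set T}) v := #|[set u in D | e v u]|.

Lemma imset_stable (f : T -> T) (D : {set T}) : injective f ->
  {in D, forall v, f v \in D} -> f @: D = D.
Proof.
move=> finj fD; apply/eqP; rewrite eqEcard card_imset // leqnn andbT.
by apply/fintype.subsetP => _ /imsetP[v vD ->]; exact: fD.
Qed.

Lemma outdeg_stable (f : T -> T) (D : {set T}) v : injective f ->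
  {in D, forall v, f v \in D} -> {in D &, forall u v, e (f u) (f v) = e u v} ->
  v \in D -> outdeg D (f v) = outdeg D v.
Proof.
move=> finj fD fe vD; rewrite /outdeg -[RHS](card_imset _ finj); apply: eq_card => u.
rewrite inE; apply/andP/imsetP => [[uD fvu]|[w + ->]].
  move: uD fvu; rewrite -{1}(imset_stable finj fD) => /imsetP[w wD ->].
  by rewrite fe // => vw; exists w; rewrite // inE wD.
by rewrite inE => /andP[wD vw]; rewrite fD // fe.
Qed.

End FiniteRelations.

Section BlockGraphs.
Local Open Scope set_scope.
Variables (p r : nat).
(** The powers of 2 let outdegrees be read in binary; they also make each block larger than the
    points and all lower blocks together. *)
Let t (k : 'I_r) := p.+2 * 2 ^ k.
Let T := blocks p t.
Variables (e : rel T) (b : T -> 'I_r -> bool).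
Hypothesis e_block : forall v k (i : 'I_(t k)), ~~ in_block k v -> e v (blk p i) = b v k.
Hypothesis b_separates :
  forall i j, (forall k, b (pt t i) k = b (pt t j) k) -> i = j.

Lemma sum_blocks (F : T -> nat) :
  \sum_v F v = \sum_i F (pt t i) + \sum_k \sum_(i < t k) F (blk p i).
Proof.
rewrite big_sumType /=; congr (_ + _).
rewrite (sig_big_dep _ _ (fun k i => F (blk p i))) /=.
by apply: eq_bigr => -[k i] _.
Qed.

Lemma outdegE (D : {set T}) v : outdeg e D v = \sum_u ((u \in D) && e v u).
Proof.
rewrite /outdeg -sum1_card big_mkcond; apply: eq_bigr => u _.
by rewrite inE; case: (_ && _).
Qed.

(** * Graph case: degrees as binary codes *)

Section Graph.
Variable c : 'I_r -> bool.
Hypothesis e_irr : irreflexive e.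
Hypothesis e_clique : forall k (i j : 'I_(t k)), i != j -> e (blk p i) (blk p j) = c k.

Let b' v k := if in_block k v then c k else b v k.

(* The base p.+2 absorbs the contribution of the p points and the missing loop. *)
Lemma outdeg_code (D : {set T}) v : (forall k (i : 'I_(t k)), blk p i \in D) ->
  (outdeg e D v).+1 %/ p.+2 = \sum_k b' v k * 2 ^ k.
Proof.
move=> Dblk; rewrite outdegE sum_blocks.
set noise := \sum_i _; set main := \sum_k _; set code := \sum_k _.
have noise_le : noise <= p.
  by rewrite -[leqRHS]card_ord -sum1_card; apply: leq_sum => i _; case: (_ && _).
(* Counts the loop missing when [v] lies in a block that is a clique. *)
pose loop := \sum_k (in_block k v && c k).
have loop_le : loop <= 1.
  rewrite /loop; elim/blocks_ind: v {main code noise noise_le loop} => [i|l i].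
    by rewrite big1.
  rewrite (bigD1 l) //= eqxx big1 ?addn0; first by case: (c l).
  by move=> k /negbTE; rewrite eq_sym => ->.
have mainE : main + loop = p.+2 * code.
  rewrite /main /loop /code -big_split big_distrr /=; apply: eq_bigr => k _.
  rewrite mulnCA -/(t k) /b'; case: ifPn => [/in_blockP[j ->]|kv].
    rewrite (bigD1 j) //= e_irr andbF add0n.
    rewrite (eq_bigr (fun=> c k : nat)); last first.
      by move=> i ij; rewrite Dblk e_clique // eq_sym.
    rewrite sum_nat_const [X in X + _]mulnC addnC -mulnS; congr (_ * _).
    have := cardC1 j; rewrite card_ord => cardj.
    by rewrite -[RHS]prednK ?cardj // muln_gt0 expn_gt0.
  rewrite addn0 (eq_bigr (fun=> b v k : nat)); last first.
    by move=> i _; rewrite Dblk e_block.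
  by rewrite sum_nat_const card_ord mulnC.
(* The added 1 keeps the remainder nonnegative, and it is at most [p.+1]. *)
have -> : (noise + main).+1 = code * p.+2 + (noise + 1 - loop) by lia.
by rewrite divnMDl // divn_small ?addn0 //; lia.
Qed.

(* Every automorphism of D preserves codes, so P' and P hold for equally many of
   the tuples of D whose codes are those of the p points; inclusion-exclusion
   over J isolates the tuple of the p points itself.  Thus a vertex outside the p
   points may share its code with one of them without harm. *)
Lemma graph_rigid (P P' : pred {ffun 'I_p -> T}) :
  (forall J : {set 'I_p}, let D := [set v | [forall j in J, v != pt t j]] in
    exists s : T -> T, [/\ injective s, {in D, forall v, s v \in D},
      {in D &, forall u v, e (s u) (s v) = e u v} &
      forall f : {ffun 'I_p -> T}, (forall i, f i \in D) ->
        P' f = P [ffun i => s (f i)]]) ->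
  P [ffun i => pt t i] -> P' [ffun i => pt t i].
Proof.
move=> HJ Ppt; set x := finfun _ in Ppt *.
pose code v := \sum_k b' v k * 2 ^ k.
pose W := [set f : {ffun 'I_p -> T} | [forall i, code (f i) == code (pt t i)]].
pose M (f : {ffun 'I_p -> T}) j := [exists i, f i == pt t j].
have codes_pt i j : code (pt t i) = code (pt t j) -> i = j.
  by move=> /binary_inj cij; apply: b_separates => k; exact: cij.
(* Each point [pt t i] occurs in [f], and by its code only at position [i]. *)
have WM f : f \in W -> [forall i, M f i] -> f = x.
  rewrite inE => /forallP fW /forallP fM; apply/ffunP => i; rewrite ffunE.
  have /existsP[j /eqP fj] := fM i.
  by have /eqP := fW j; rewrite fj => /codes_pt ij; rewrite -ij in fj *.
have xW : x \in W by rewrite inE; apply/forallP => i; rewrite ffunE.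
have xM : [forall i, M x i].
  by apply/forallP => i; apply/existsP; exists i; rewrite ffunE.
suff eqPP' : #|[set f in W | [forall i, M f i] && P f]| =
             #|[set f in W | [forall i, M f i] && P' f]|.
  have : 0 < #|[set f in W | [forall i, M f i] && P' f]|.
    by rewrite -eqPP' card_gt0; apply/set0Pn; exists x; rewrite inE xW xM.
  rewrite card_gt0 => /set0Pn[f]; rewrite inE => /andP[fW /andP[fM]].
  by rewrite (WM f).
apply: inclusion_exclusion => J; have := HJ J.
set D := [set v | _] => -[s [sinj sD se sP]].
have Dblk k (i : 'I_(t k)) : blk p i \in D by rewrite inE; apply/forall_inP.
have scode v : v \in D -> code (s v) = code v.
  move=> vD; rewrite /code -!(outdeg_code _ Dblk).
  by rewrite (outdeg_stable sinj).
pose phi (f : {ffun 'I_p -> T}) := [ffun i => s (f i)].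
have phi_inj : injective phi.
  by move=> f g /ffunP fg; apply/ffunP => i; have := fg i; rewrite !ffunE => /sinj.
(* [phi] permutes the tuples of [W] lying in [D] and matches [P'] with [P]. *)
pose E := [set f in W | [forall i, f i \in D]].
have phiE : {in E, forall f, phi f \in E}.
  move=> f; rewrite !inE => /andP[/forallP fW /forallP fD].
  apply/andP; split; apply/forallP => i; rewrite ffunE.
    by rewrite scode.
  exact: sD.
have avoidE f : [forall j in J, ~~ M f j] = [forall i, f i \in D].
  apply/forall_inP/forallP => [h i|h j jJ].
    rewrite inE; apply/forall_inP => j /h; rewrite negb_exists => /forallP; exact.
  rewrite negb_exists; apply/forallP => i.
  by have := h i; rewrite inE => /forall_inP; apply.
rewrite -[RHS](card_imset _ phi_inj); apply: eq_card => f.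
have inE' (F : pred {ffun 'I_p -> T}) g :
    (g \in [set f in W | [forall j in J, ~~ M f j] && F f]) = (g \in E) && F g.
  by rewrite !inE avoidE andbA.
rewrite inE'; apply/andP/imsetP => [[]|[g]].
  rewrite -{1}(imset_stable phi_inj phiE) => /imsetP[g gE ->] Pg.
  exists g; rewrite // inE' gE /= sP //.
  by move: gE; rewrite inE => /andP[_ /forallP].
rewrite inE' => /andP[gE P'g] ->; split; first exact: phiE.
by rewrite -sP //; move: gE; rewrite inE => /andP[_ /forallP].
Qed.

End Graph.

(** * Tournament case: rigidity *)

Section Tournament.
Variable c : 'I_r -> bool.
Hypothesis e_irr : irreflexive e.
Hypothesis e_tour : forall u v, u != v -> e v u = ~~ e u v.
Hypothesis e_linear :
  forall k (i j : 'I_(t k)), i < j -> e (blk p i) (blk p j) = c k.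
Variable f : T -> T.
Hypotheses (f_inj : injective f) (f_e : forall u v, e (f u) (f v) = e u v).

Lemma block_gt0 (k : 'I_r) : 0 < t k.
Proof. by rewrite muln_gt0 expn_gt0. Qed.

Section TopBlock.
Variable k : 'I_r.
Hypothesis f_above : forall (l : 'I_r) (i : 'I_(t l)), k < l -> f (blk p i) = blk p i.

(** Blocks are treated from the top down: those above [k] are fixed, hence can be removed, which
    leaves [D]; [D'] lacks block [k] too. *)
Let D := [set v : T | [forall l : 'I_r, (k < l) ==> ~~ in_block l v]].
Let D' := [set v : T | [forall l : 'I_r, (k <= l) ==> ~~ in_block l v]].

Lemma blk_top (i : 'I_(t k)) : blk p i \in D.
Proof.
rewrite inE; apply/forallP => l; apply/implyP => kl /=.
by apply: contraTneq kl => ->; rewrite ltnn.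
Qed.

Lemma top_stable : {in D, forall v, f v \in D}.
Proof.
move=> v; rewrite !inE => /forallP vD; apply/forallP => l; apply/implyP => kl.
apply/in_blockP => -[i fv]; have := vD l; rewrite kl /=.
suff -> : v = blk p i by rewrite /= eqxx.
by apply: f_inj; rewrite fv f_above.
Qed.

Lemma top_split v : (v \in D) = (v \in D') || in_block k v.
Proof.
rewrite !inE; apply/forallP/orP => [vD|[/forallP vD' l|/in_blockP[i ->] l]].
- case: (boolP (in_block k v)) => [|nvk]; first by right.
  left; apply/forallP => l; apply/implyP; rewrite leq_eqVlt => /orP[/eqP/val_inj <-//|].
  by have := vD l => /implyP.
- by apply/implyP => /ltnW kl; have := vD' l; rewrite kl.
- by have := blk_top i; rewrite inE => /forallP.
Qed.

Lemma bottom_block v : v \in D' -> ~~ in_block k v.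
Proof. by rewrite inE => /forallP/(_ k); rewrite leqnn. Qed.

(** The geometric sum gives [p + p.+2 * (2 ^ k - 1) < p.+2 * 2 ^ k]. *)
Lemma card_bottom : #|D'| < t k.
Proof.
rewrite -sum1_card big_mkcond /= sum_blocks.
have -> : \sum_(l < r) \sum_(i < t l) (if blk p i \in D' then 1 else 0) =
          \sum_(l < r | l < k) t l.
  rewrite [RHS]big_mkcond; apply: eq_bigr => l _.
  have -> : (if l < k then t l else 0) = \sum_(i < t l) (l < k : nat).
    by rewrite sum_nat_const card_ord; case: ifP; rewrite ?muln1 ?muln0.
  apply: eq_bigr => i _; case: ifPn => [|niD'].
    by rewrite inE => /forallP/(_ l); rewrite /= eqxx implybF -ltnNge => ->.
  case: (ltnP l k) => // lk; case/negP: niD'.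
  rewrite inE; apply/forallP => m; apply/implyP => km /=.
  by apply: contraTneq km => <-; rewrite -ltnNge.
rewrite -(big_ord_widen r (fun l => p.+2 * 2 ^ l) (ltnW (ltn_ord k))) -big_distrr /=.
have pts : \sum_(i < p) (if pt t i \in D' then 1 else 0) <= p.
  by rewrite -[leqRHS]card_ord -sum1_card; apply: leq_sum => i _; case: ifP.
have := predn_exp 2 k; rewrite mul1n => <-.
rewrite /t; case: (2 ^ k) (expn_gt0 2 k) => [//|q] _ /=.
rewrite mulnS -addSn leq_add2r ltnS; exact: leq_trans pts (leqnSn _).
Qed.

Lemma outdeg_top v :
  outdeg e D v = outdeg e D' v + \sum_(i < t k) e v (blk p i).
Proof.
rewrite !outdegE.
transitivity (\sum_u ((u \in D') && e v u + in_block k u && e v u)).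
  apply: eq_bigr => u _; rewrite top_split.
  by case: (boolP (u \in D')) => [/bottom_block/negbTE ->|//]; rewrite addn0.
rewrite big_split; congr (_ + _); rewrite sum_blocks /= big1 // add0n.
rewrite (bigD1 k) //= [X in _ + X]big1 ?addn0.
  by apply: eq_bigr => i _; rewrite eqxx.
by move=> l /negbTE lk; rewrite big1 // => i _; rewrite lk.
Qed.

(** A block is linearly ordered, in a direction given by [c k], so inner outdegree determines
    position. *)
Lemma inner_outdeg (i : 'I_(t k)) :
  \sum_(j < t k) e (blk p i) (blk p j) = if c k then (t k).-1 - i else i.
Proof.
have lower m : m <= t k -> \sum_(j < t k) (j < m) = m.
  move=> mt; rewrite -[RHS]card_ord -sum1_card (big_ord_widen _ (fun=> 1) mt).
  by rewrite [RHS]big_mkcond.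
transitivity (\sum_(j < t k) (if c k then i < j else j < i)).
  apply: eq_bigr => j _; case: (ltngtP i j) => [ij|ji|/val_inj ->].
  - by rewrite e_linear //; case: (c k).
  - have ne : blk p j != blk p i by apply: contraTneq ji => /blk_inj ->; rewrite ltnn.
    by rewrite (e_tour ne) e_linear //; case: (c k).
  - by rewrite e_irr; case: (c k).
case: (c k); last by rewrite lower // ltnW.
have -> : \sum_(j < t k) (i < j) = t k - \sum_(j < t k) (j < i.+1).
  apply/esym/eqP; rewrite -(eqn_add2r (\sum_(j < t k) (j < i.+1))) subnK.
    rewrite -big_split /= (eq_bigr (fun=> 1)); last first.
      by move=> j _; rewrite ltnS; case: (leqP j i).
    by rewrite sum1_card card_ord.
  by rewrite lower.
by rewrite lower //; lia.
Qed.

Lemma outdeg_block (i j : 'I_(t k)) :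
  outdeg e D' (blk p i) = outdeg e D' (blk p j).
Proof.
apply: eq_card => u; rewrite inE [RHS]inE; case: (boolP (u \in D')) => //= uD'.
have ne l : u != blk p (l : 'I_(t k)).
  by apply: contraNneq (bottom_block uD') => ->; rewrite /= eqxx.
by rewrite !(e_tour (ne _)) !e_block ?bottom_block.
Qed.

(* A vertex below the block has outdegree either < #|D'| or >= t k > #|D'|, so
   the vertex of the block with outdegree #|D'| is determined. *)
Lemma fixed_in_block : exists i : 'I_(t k), f (blk p i) = blk p i.
Proof.
have lt := card_bottom.
pose q := outdeg e D' (blk p (Ordinal (block_gt0 k))).
have qle : q <= #|D'|.
  by apply: subset_leq_card; apply/fintype.subsetP => u; rewrite inE => /andP[].
(* Every vertex of the block has outdegree [q] into [D']; the inner outdegree must supply the rest,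
   which is below [t k]. *)
have [i Ei] : exists i : 'I_(t k), (if c k then (t k).-1 - i else i) = #|D'| - q.
  case: (c k).
    have lt' : (t k).-1 - (#|D'| - q) < t k by lia.
    by exists (Ordinal lt'); rewrite -[nat_of_ord _]/((t k).-1 - (#|D'| - q)) subKn; lia.
  have lt' : #|D'| - q < t k by lia.
  by exists (Ordinal lt').
exists i; have degi : outdeg e D (blk p i) = #|D'|.
  rewrite outdeg_top inner_outdeg Ei (outdeg_block i (Ordinal (block_gt0 k))) -/q.
  by rewrite subnKC.
have := outdeg_stable f_inj top_stable (in2W f_e) (blk_top i); rewrite degi.
have := top_stable (blk_top i); rewrite top_split => /orP[fiD'|/in_blockP[j ->]].
  have nk := bottom_block fiD'.
  rewrite outdeg_top (eq_bigr (fun=> b (f (blk p i)) k : nat)); last first.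
    by move=> j _; rewrite e_block.
  rewrite sum_nat_const card_ord.
  have : outdeg e D' (f (blk p i)) < #|D'|.
    rewrite [leqRHS](cardsD1 (f (blk p i))) fiD' ltnS; apply: subset_leq_card.
    apply/fintype.subsetP => u; rewrite !inE => /andP[-> eu]; rewrite andbT.
    by apply: contraTneq eu => ->; rewrite e_irr.
  case: (b _ k); rewrite ?muln1 ?muln0 => dlt deg; lia.
rewrite outdeg_top inner_outdeg (outdeg_block j i).
move: degi; rewrite outdeg_top inner_outdeg => <- /addnI.
move=> ji; congr blk; apply: val_inj => /=; move: ji.
by case: (c k) => //; have := ltn_ord i; have := ltn_ord j; lia.
Qed.

(* Two consecutive vertices of the block form a module; an automorphism that
   fixes one of them and moves the other from v to v' would give both
   [e v v'] and [e v' v] the same value. *)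
Lemma fixed_neighbour (i j : 'I_(t k)) : (j == i.+1 :> nat) || (i == j.+1 :> nat) ->
  f (blk p i) = blk p i -> f (blk p j) = blk p j.
Proof.
move=> ij fw; set v := blk p j; set w := blk p i in fw; apply/eqP/negPn/negP => fv.
have vw : v != w.
  by apply: contraTneq ij => /blk_inj ->; rewrite orbb ltn_eqF.
have module u : u \in D -> u != v -> u != w -> e u v = e u w.
  rewrite top_split => /orP[/bottom_block uk|/in_blockP[l ->]] lv lw.
    by rewrite !e_block.
  have lj : l != j by apply: contraNneq lv => ->.
  have li : l != i by apply: contraNneq lw => ->.
  case: (ltnP l j) => [lltj|jlel].
    have llti : l < i by move: lj li ij lltj; rewrite -!val_eqE /=; lia.
    by rewrite !e_linear.
  have jltl : j < l by move: lj; rewrite -val_eqE /=; lia.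
  have iltl : i < l by move: lj li ij jltl; rewrite -!val_eqE /=; lia.
  rewrite (e_tour (u := v)) 1?eq_sym // (e_tour (u := w)) 1?eq_sym //.
  by rewrite !e_linear.
have vD : v \in D by exact: blk_top.
have fvw : f v != w by rewrite -fw (inj_eq f_inj).
have e1 : e (f v) v = e v w by rewrite module ?top_stable // -{1}fw f_e.
have [u uD fu] : exists2 u, u \in D & f u = v.
  by move: vD; rewrite -{1}(imset_stable f_inj top_stable) => /imsetP[u uD ->]; exists u.
(* With [v = f u], this is [e u v = e u w], carried back by [f], which fixes [w]. *)
have e2 : e v (f v) = e v w.
  rewrite -{1}fu f_e module // -1?f_e ?fu ?fw //.
    by apply: contraNneq fv => uv; rewrite -uv fu uv.
  by apply: contraNneq vw => uw; rewrite -fu uw fw.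
by move: e2; rewrite (e_tour fv) e1; case: (e v w).
Qed.

Lemma fixed_block (i : 'I_(t k)) : f (blk p i) = blk p i.
Proof.
have [i0 fi0] := fixed_in_block.
suff fixed d (j : 'I_(t k)) : (j == i0 + d :> nat) || (i0 == j + d :> nat) ->
    f (blk p j) = blk p j.
  (* With truncated subtraction this is the distance between [i] and [i0]. *)
  apply: (fixed ((i - i0) + (i0 - i))); lia.
elim: d j => [|d IH] j.
  by rewrite !addn0 eq_sym orbb => /eqP/val_inj <-.
case/orP => /eqP jd; have ltj := ltn_ord j; have lti0 := ltn_ord i0.
  have lt : j.-1 < t k by lia.
  by apply: (@fixed_neighbour (Ordinal lt)); last apply: IH; rewrite /=; lia.
have lt : j.+1 < t k by lia.
by apply: (@fixed_neighbour (Ordinal lt)); last apply: IH; rewrite /=; lia.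
Qed.

End TopBlock.

Lemma fixed_blocks (k : 'I_r) (i : 'I_(t k)) : f (blk p i) = blk p i.
Proof.
suff fixed m (l : 'I_r) (j : 'I_(t l)) : r <= m + l -> f (blk p j) = blk p j.
  by apply: (fixed r); exact: leq_addr.
elim: m l j => [|m IH] l j; first by rewrite leqNgt ltn_ord.
move=> rml; apply: fixed_block => l' j' ll'; apply: IH.
by apply: leq_trans rml _; rewrite addSnnS leq_add2l.
Qed.

(** With all blocks fixed, a point goes to a point with the same relations to them, and these
    separate points. *)
Lemma tournament_rigid (i : 'I_p) : f (pt t i) = pt t i.
Proof.
elim/blocks_ind E : (f (pt t i)) => [j|k j]; last first.
  by have /f_inj : f (pt t i) = f (blk p j) by rewrite fixed_blocks.
congr pt; apply: b_separates => k.
have := f_e (pt t i) (blk p (Ordinal (block_gt0 k))).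
by rewrite fixed_blocks E !e_block.
Qed.

End Tournament.

End BlockGraphs.

(** * Transfer from subsets to tuples *)

Lemma card_finset_II (T : finType) (D : {set T}) : ([set` D] #= `I_#|D|)%card.
Proof.
apply: card_esym; have <- : index^~ (enum D) @` [set` D] = `I_#|D|.
  apply/seteqP; split=> [_ [v /= vD <-]|i /= iD].
    by rewrite cardE index_mem mem_enum.
  exists (enum_val (Ordinal iD)); first exact: enum_valP.
  by rewrite (enum_val_nth (enum_val (Ordinal iD))) index_uniq ?enum_uniq -?cardE.
apply: inj_card_eq => u v /set_mem uD /set_mem vD uv.
have {}uD : u \in enum D by rewrite mem_enum.
have {}vD : v \in enum D by rewrite mem_enum.
by rewrite -(nth_index u uD) uv nth_index.
Qed.

Lemma card_ordered_pairs p :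
  #|[set ij : 'I_p * 'I_p | ij.1 < ij.2]%SET|.*2 = p * p.-1.
Proof.
have -> : #|[set ij : 'I_p * 'I_p | ij.1 < ij.2]%SET| =
    \sum_(i < p) \sum_(j < p) (i < j).
  rewrite -sum1_card big_mkcond pair_big /=; apply: eq_bigr => -[i j] _.
  by rewrite inE /=; case: ifP.
rewrite -addnn [X in _ + X]exchange_big -big_split /=.
rewrite (eq_bigr (fun=> p.-1)) => [|i _]; first by rewrite sum_nat_const card_ord.
have := cardC1 i; rewrite card_ord => <-; rewrite -sum1_card [RHS]big_mkcond -big_split.
by apply: eq_bigr => j _; rewrite inE /= -val_eqE /=; case: ltngtP.
Qed.

Lemma card_blocks_bound n p r : p <= n -> r.*2 <= p * p.-1 ->
  #|blocks p (fun k : 'I_r => p.+2 * 2 ^ k)| <= n + 2 ^ (n ^ 2 - n + 2) - 2.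
Proof.
move=> pn r2; rewrite -sum1_card sum_blocks sum1_card card_ord.
rewrite (eq_bigr (fun k : 'I_r => p.+2 * 2 ^ k)); last first.
  by move=> k _; rewrite sum1_card card_ord.
rewrite -big_distrr /=; have := predn_exp 2 r; rewrite mul1n => <-.
have powgt0 := expn_gt0 2 r.
(* The total is [p + p.+2 * (2 ^ r - 1) = p.+2 * 2 ^ r - 2]. *)
suff : p.+2 * 2 ^ r <= 2 ^ (n ^ 2 - n + 2) by nia.
have [q q2] : exists q, q.*2 = p * p.-1.
  exists (p * p.-1)./2; rewrite -[RHS]odd_double_half.
  by case: p {pn r2} => // p; rewrite /= oddM /= andNb.
(* Since [r <= q], the product is at most [2 ^ (q.*2 + 2)], where [q.*2 = p * p.-1]. *)
have pq : p.+2 <= 2 ^ q.+2.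
  by apply: leq_trans (ltn_expl _ (leqnn 2)); move: q2; clear; case: p => // p; nia.
apply: (@leq_trans (2 ^ q.+2 * 2 ^ q)).
  by apply: leq_mul => //; rewrite leq_exp2l // -leq_double q2.
rewrite -expnD leq_exp2l // addSn addSn addnn q2.
rewrite -addn2 leq_add2r -mulnn -{3}[n]muln1 -mulnBr subn1.
by apply: leq_mul => //; lia.
Qed.

(** * Matching elements of [G] by elements of [H] on finite sets *)

Section Orbits.
Variables (X : Type) (G H : set (Sym X)) (N : nat).
Hypotheses (G_group : permutation_group G) (H_group : permutation_group H).
Hypothesis HG : H `<=` G.
Hypothesis same_subsets : forall l, 0 < l -> l <= N -> same_orbits_on_subsets l G H.

Lemma same_image (g : Sym X) (A : set X) l : G g -> (A #= `I_l)%card -> l <= N ->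
  exists2 h, H h & h @` A = g @` A.
Proof.
(* The empty set is treated apart, as only sizes [l > 0] are assumed. *)
move=> Gg Al lN; case: (posnP l) => [l0|l_gt0].
  have -> : A = set0 by apply/eqP; rewrite -(@card_eq0 _ nat); rewrite l0 II0 in Al.
  by exists 1%g; [exact: permutation_group1 | rewrite !image_set0].
have [B _ BA] : sym_orbits (@subset_act X) H (@lsubsets X l)
    (sym_orbit (@subset_act X) G A).
  by rewrite -same_subsets //; exists A.
have [h1 Hh1 h1B] : sym_orbit (@subset_act X) H B A.
  rewrite BA; exists 1%g; first exact: permutation_group1.
  by rewrite /subset_act image_id.
have [h2 Hh2 h2B] : sym_orbit (@subset_act X) H B (g @` A).
  by rewrite BA; exists g.
exists (h2 * h1^-1)%g.
  exact: permutation_groupM (permutation_groupV _ _).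
rewrite -h2B -h1B /subset_act -image_comp; congr (_ @` _).
by rewrite image_comp -[RHS]image_id; apply: eq_imagel => x _; exact: sym_invK.
Qed.

(** On [D], [s] is [h^-1 g] read through [a], and it preserves [R] as [h] is in [G]; it is the
    identity elsewhere, so injective throughout. *)
Lemma transport (T : finType) (a : T -> X) (D : {set T}) (R : rel X) (g : Sym X) :
  injective a -> rel_invariant G R -> G g -> #|T| <= N ->
  exists (h : Sym X) (s : T -> T), [/\ H h, injective s, {in D, forall v, s v \in D},
    {in D &, forall u v, R (a (s v)) (a (s u)) = R (a v) (a u)} &
    {in D, forall v, h (a (s v)) = g (a v)}].
Proof.
move=> ainj Rinv Gg TN.
have aD : (a @` [set` D] #= `I_#|D|)%card.
  by rewrite (card_eql (inj_card_eq (in2W ainj))) card_finset_II.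
have [h Hh hA] := same_image Gg aD (leq_trans (max_card _) TN).
have ex v : exists u, if v \in D then u \in D /\ h (a u) = g (a v) else u = v.
  case: (boolP (v \in D)) => vD; last by exists v.
  have : (h @` (a @` [set` D])) (g (a v)) by rewrite hA; exists (a v) => //; exists v.
  by case=> _ [u uD <-] hu; exists u.
have [s sP] := choice ex.
have sD v : v \in D -> s v \in D /\ h (a (s v)) = g (a v).
  by move=> vD; have := sP v; rewrite vD.
have sND v : v \notin D -> s v = v by move=> /negbTE vD; have := sP v; rewrite vD.
exists h, s; split=> //.
- move=> u v suv; case: (boolP (u \in D)) => uD; case: (boolP (v \in D)) => vD.
  + have [_ hu] := sD u uD; have [_ hv] := sD v vD.
    by apply: ainj; apply: (@sym_inj _ g); rewrite -hu -hv suv.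
  + by have [] := sD u uD; rewrite suv sND // (negbTE vD).
  + by have [] := sD v vD; rewrite -suv sND // (negbTE uD).
  + by rewrite -(sND u) // -(sND v).
- by move=> v /sD[].
- move=> u v /sD[_ hu] /sD[_ hv].
  by rewrite -[LHS](Rinv h) ?hu ?hv ?Rinv //; exact: HG.
- by move=> v /sD[].
Qed.

End Orbits.

Lemma same_orbits_injective (X : Type) (G H : set (Sym X)) (n p : nat)
  (x : 'I_p -> X) (g : Sym X) :
  infinite_set [set: X] -> permutation_group G -> permutation_group H ->
  primitive G -> ~ two_transitive G -> H `<=` G ->
  (forall l : nat, 0 < l ->
     l <= n + 2 ^ (n ^ 2 - n + 2) - 2 -> same_orbits_on_subsets l G H) ->
  p <= n -> injective x -> G g ->
  exists2 h, H h & forall i, h (x i) = g (x i).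
Proof.
move=> Xinf Ggrp Hgrp Gprim G2 HG same pn xinj Gg.
have [R [Rirr Rinv Rsep Rcase]] := orbital_separating Xinf Gprim Ggrp G2.
pose pairs := [set ij : 'I_p * 'I_p | ij.1 < ij.2]%SET.
pose r := #|pairs|; pose pair (k : 'I_r) := enum_val k.
pose t (k : 'I_r) := p.+2 * 2 ^ k.
have Zinf k : infinite_set (separators R (x (pair k).1) (x (pair k).2)).
  apply: Rsep => /xinj eqk; have := enum_valP k.
  by rewrite inE -/(pair k) eqk ltnn.
have [a [b [c [d [ainj apt aZ ab acd]]]]] := @uniform_blocks p r t X R x _ xinj Zinf.
pose e : rel (blocks p t) := fun v u => R (a v) (a u).
have b_separates i j : (forall k, b (pt t i) k = b (pt t j) k) -> i = j.
  move=> bij; apply/eqP/negPn/negP => ij.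
  wlog lt : i j bij ij / i < j.
    move=> W; have := ij; rewrite -val_eqE neq_ltn => /orP[|] lt; first exact: (W i j).
    by apply: (W j i) => //; rewrite eq_sym.
  (* The block of this pair consists of separators of [x i] and [x j], so [b] differs there. *)
  have ijP : (i, j) \in pairs by rewrite inE.
  pose k := enum_rank_in ijP (i, j).
  have pk : pair k = (i, j) by rewrite /pair enum_rankK_in.
  have t0 : 0 < t k by rewrite muln_gt0 expn_gt0.
  have := aZ k (Ordinal t0); rewrite pk /separators /= -!apt !ab //.
  by rewrite bij eqxx.
have TN : #|blocks p t| <= n + 2 ^ (n ^ 2 - n + 2) - 2.
  by apply: card_blocks_bound => //; rewrite card_ordered_pairs.
have tr D := transport Ggrp Hgrp HG same D ainj Rinv Gg TN.
case: Rcase => [Rsym|Rtour].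
  pose P (w : 'I_p -> X) := `[< exists2 h, H h & forall i, h (x i) = w i >].
  suff : P (fun i => g (x i)) by move=> /asboolP.
  have e_clique k (i j : 'I_(t k)) : i != j -> e (blk p i) (blk p j) = c k.
    rewrite neq_ltn => /orP[ij|ji]; first by case: (acd _ _ _ ij).
    by rewrite /e Rsym; case: (acd _ _ _ ji).
  (* [P] says that a tuple lies in the [H]-orbit of [x], [P'] that its image under [g] does; [h]
     relates the two along [s]. *)
  have := @graph_rigid p r e b ab b_separates c (fun v => Rirr _) e_clique
    (fun f => P (fun i => a (f i))) (fun f => P (fun i => g (a (f i)))).
  move=> rigid; have /asboolP[h Hh hx] : P (fun i => g (a ([ffun i => pt t i] i))).
    apply: rigid => [J D|].
      have [h [s [Hh sinj sD sR hs]]] := tr D.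
      exists s; split=> // [u v uD vD|f fD]; first exact: sR.
      apply: asbool_equiv_eq; split=> -[h' Hh' h'x].
        exists (h^-1 * h')%g; first exact: permutation_groupM (permutation_groupV _ _) _.
        by move=> i; rewrite ffunE -[LHS]/(h^-1%g (h' (x i))) h'x -hs // sym_invK.
      exists (h * h')%g; first exact: permutation_groupM.
      by move=> i; rewrite -hs // -[LHS]/(h (h' (x i))) h'x ffunE.
    apply/asboolP; exists 1%g; first exact: permutation_group1.
    by move=> i; rewrite ffunE apt.
  by apply/asboolP; exists h => // i; rewrite hx ffunE apt.
have [h [s [Hh sinj _ sR hs]]] := tr [set: _]%SET.
have e_tour (u v : blocks p t) : u != v -> e v u = ~~ e u v.
  by move=> /eqP uv; apply: Rtour => /ainj.
have e_linear k (i j : 'I_(t k)) : i < j -> e (blk p i) (blk p j) = c k.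
  by move=> /acd[].
have s_e u v : e (s u) (s v) = e u v by apply: sR; rewrite inE.
exists h => // i; rewrite -apt -hs ?inE //; congr (h (a _)).
exact/esym/(@tournament_rigid p r e b ab b_separates c (fun v => Rirr _) e_tour
  e_linear s sinj s_e).
Qed.

Theorem theorem4p1 (X : Type) (G H : set (Sym X)) (n : nat)
  (X_infinite : infinite_set [set: X])
  (G_closed : closed_permutation_group G)
  (H_closed : closed_permutation_group H)
  (G_primitive : primitive G)
  (G_not_2transitive : ~ two_transitive G)
  (HG : H `<=` G)
  (same_subsets : forall l : nat, 0 < l ->
     l <= n + 2 ^ (n ^ 2 - n + 2) - 2 -> same_orbits_on_subsets l G H) :
  forall m : nat, m <= n -> same_orbits_on_tuples m G H.
Proof.
move=> m mn; have [[Ggrp _] [Hgrp _]] := (G_closed, H_closed).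
suff orbitE t : sym_orbit (@tuple_act X m) G t = sym_orbit (@tuple_act X m) H t.
  by apply/seteqP; split=> _ [t _ <-]; exists t.
apply/seteqP; split=> _ [g Gg <-]; last by exists g => //; exact: HG.
(* Repeated entries are dropped, to reach an injective tuple; [{classic X}] supplies decidable
   equality. *)
pose u := undup (t : seq {classic X}).
have uinj : injective (tnth (in_tuple u)) by apply/tuple_uniqP/undup_uniq.
have um : size u <= n.
  by apply: leq_trans mn; rewrite -[leqRHS](size_tuple t); exact: size_undup.
have [h Hh hu] := same_orbits_injective X_infinite Ggrp Hgrp G_primitive
  G_not_2transitive HG same_subsets um uinj Gg.
exists h => //; apply: val_inj => /=.
apply/(@eq_in_map {classic X}) => y; rewrite -mem_undup => /(@tnthP _ _ (in_tuple u)).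
by case=> i ->.
Qed.
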